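(* With $\widetilde{\sigma}(\boldsymbol{X})$ the $(p+q)\times(p+q)$ matrix with entries polynomials in $z_{i,j},\xi_{i,j}$ ($i\in[p],j\in[q]$) and $u$ defined in the context (case $\mathfrak{g}=\mathfrak{sl}_{p+q}$, $p\ge q$), and $\gamma_k=\sum_{I\subset[p],\,J\subset[q],\,|I|=|J|=k}\det(z^I_J)\det(\xi^I_J)$, one has $$\det\bigl(\widetilde{\sigma}(\boldsymbol{X})\bigr)=(-1)^q\sum_{k=0}^{q}\Bigl(u+\gamma_1-\tfrac{p}{p+q}s\Bigr)^{p-k}\Bigl(u+\gamma_1-\tfrac{q}{p+q}s\Bigr)^{q-k}\bigl(s-(u+\gamma_1)\bigr)^{k}\,\gamma_k .$$
   Context: Fix integers $p\ge q\ge 1$ and $s\in\mathbb{Z}$; $[m]=\{1,\dots,m\}$. Let $z_{i,j},\xi_{i,j}$ ($i\in[p],j\in[q]$) and $u$ be commuting indeterminates. For $I\subset[p]$, $J\subset[q]$, $z^I_J$ and $\xi^I_J$ are the submatrices of $(z_{i,j})$, $(\xi_{i,j})$ with row indices in $I$ and column indices in $J$; the empty determinant is $1$. Thus $\gamma_0=1$ and $\gamma_1=\sum_{k\in[p],l\in[q]}z_{k,l}\xi_{k,l}$. ($\gamma_k$ is the principal symbol of the $\mathrm{GL}_p\times\mathrm{GL}_q$-invariant differential operator $\varGamma_k=\sum_{|I|=|J|=k}\det(z^I_J)\det(\partial^I_J)$ on $p\times q$ matrices, where $\partial_{i,j}=\partial/\partial z_{i,j}$.) $E_{a,b}$ denotes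 the $(p+q)\times(p+q)$ matrix units. Take the basis of $\mathfrak{sl}_{p+q}$ (complexified Lie algebra of $\mathrm{SU}(p,q)$) consisting of $H_a=E_{a,a}-E_{p+q,p+q}$ ($1\le a\le p+q-1$), $E^+_{i,j}=E_{i,j}$ ($i\ne j\in[p]$), $E^-_{i,j}=E_{p+i,p+j}$ ($i\neq j\in[q]$), $X^+_{i,j}=E_{i,p+j}$, $X^-_{i,j}=E_{p+j,i}$ ($i\in[p],j\in[q]$). The dual basis with respect to the bilinear form $\operatorname{tr}(XY)$ is $H_a^\vee=H_a-\frac1{p+q}\sum_{k=1}^{p+q-1}H_k$, $(E^\pm_{i,j})^\vee=E^\pm_{j,i}$, $(X^\pm_{i,j})^\vee=X^\mp_{i,j}$. Define polynomials $$\widetilde\sigma(H_i^\vee)=\Bigl(u-\tfrac{p}{p+q}s\Bigr)+\sum_{k\in[p],l\in[q],\,k\ne i}z_{k,l}\xi_{k,l}\quad(1\le i\le p),$$ $$\widetilde\sigma(H_{p+j}^\vee)=\Bigl(-u+\tfrac{q}{p+q}s\Bigr)-\sum_{k\in[p],l\in[q],\,l\ne j}z_{k,l}\xi_{k,l}\quad(1\le j\le q-1),$$ $$\widetilde\sigma(E^+_{i,j})=-\sum_{l=1}^q z_{j,l}\xi_{i,l},\qquad \widetilde\sigma(E^-_{i,j})=\sum_{k=1}^p z_{k,i}\xi_{k,j},\qquad \widetilde\sigma(X^+_{i,j})=-\xi_{i,j},$$ $$\widetilde\sigma(X^-_{i,j})=-u z_{i,j}-\sum_{k\in[p],l\in[q],\,k\ne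 i,\,l\ne j}(z_{i,j}z_{k,l}-z_{i,l}z_{k,j})\,\xi_{k,l}.$$ (These arise from the principal symbols, $\partial_{i,j}\mapsto\xi_{i,j}$, of the differential operators by which $\mathfrak{sl}_{p+q}$ acts in the holomorphic discrete series of $\mathrm{SU}(p,q)$ induced from the character $\left[\begin{smallmatrix}a&0\\c&d\end{smallmatrix}\right]\mapsto(\det d)^{-s}$ of the maximal parabolic subgroup, by rewriting those containing $s$ in terms of $\gamma_1$ and substituting $s-u$ for $\gamma_1$.) Put $$\widetilde\sigma(\boldsymbol X)=\sum_{a=1}^{p+q-1}\widetilde\sigma(H_a^\vee)H_a+\sum_{i\ne j\in[p]}\widetilde\sigma(E^+_{j,i})E^+_{i,j}+\sum_{i\neq j\in[q]}\widetilde\sigma(E^-_{j,i})E^-_{i,j}+\sum_{i\in[p],j\in[q]}\bigl(\widetilde\sigma(X^-_{i,j})X^+_{i,j}+\widetilde\sigma(X^+_{i,j})X^-_{i,j}\bigr).$$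
   Formalization: The (p+q,p+q) entry is taken from the formula for σ̃(H_{p+j}^∨) at j=q, not from the expansion along H_1,…,H_{p+q-1}; the literal matrix agrees for p=q, but for p>q the formula fails (p=2,q=1,s=0,z=ξ=0,u=1: −2 versus −1). *)

(* Defs.v *)
From mathcomp Require Import all_boot all_order all_algebra.
From mathcomp.multinomials Require Import mpoly.
From mathcomp Require Import ring.

Set Implicit Arguments.
Unset Strict Implicit.
Unset Printing Implicit Defensive.

Import GRing.Theory.
Local Open Scope ring_scope.

(* The polynomial ring F[z_(i,j), xi_(i,j), u] in 2pq + 1 indeterminates.     *)
Definition pring (F : fieldType) (p q : nat) := {mpoly F[p * q + p * q + 1]}.

Definition zX (F : fieldType) (p q : nat) : 'M[pring F p q]_(p, q) :=
  \matrix_(i, j) 'X_(lshift 1 (lshift (p * q) (mxvec_index i j))).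

Definition xiX (F : fieldType) (p q : nat) : 'M[pring F p q]_(p, q) :=
  \matrix_(i, j) 'X_(lshift 1 (rshift (p * q) (mxvec_index i j))).

Definition uX (F : fieldType) (p q : nat) : pring F p q :=
  'X_(rshift (p * q + p * q) ord0).

(* det of z^I_J. conform_mx only casts 'M_(#|I|, #|J|) to 'M_k: the value is  *)
(* used for #|I| = #|J| = k only (otherwise the default matrix 0 is taken).   *)
Definition minor (A : comNzRingType) (p q k : nat) (z : 'M[A]_(p, q))
    (I : {set 'I_p}) (J : {set 'I_q}) : A :=
  \det (conform_mx (0 : 'M[A]_k)
     (mxsub (@enum_val _ (mem I)) (@enum_val _ (mem J)) z)).

Definition gamma (A : comNzRingType) (p q : nat) (z xi : 'M[A]_(p, q))
    (k : nat) : A :=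
  \sum_(I : {set 'I_p} | #|I| == k) \sum_(J : {set 'I_q} | #|J| == k)
     minor k z I J * minor k xi I J.

(* The polynomials attached to the dual basis of sl_(p+q). A is any           *)
(* commutative F-algebra, to be specialized to pring F p q.                   *)
(* For 1 <= a <= p+q-1 the dual vector H_a^v is E_(a,a) - (p+q)^-1 I;         *)
(* sigmaH uses this also for a = p+q, i.e. the formula for a = p+j is taken   *)
(* for all 1 <= j <= q.                                                       *)
Definition sigmaH (F : fieldType) (A : comAlgType F) (p q : nat) (s : int)
    (z xi : 'M[A]_(p, q)) (u : A) (a : 'I_(p + q)) : A :=
  match split a with
  | inl i => (u - (p%:R / (p + q)%:R * s%:~R)%:A)
             + \sum_(k < p | k != i) \sum_(l < q) z k l * xi k l
  | inr j => (- u + (q%:R / (p + q)%:R * s%:~R)%:A)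
             - \sum_(k < p) \sum_(l < q | l != j) z k l * xi k l
  end.

Definition sigmaEp (A : comNzRingType) (p q : nat) (z xi : 'M[A]_(p, q))
    (i j : 'I_p) : A :=
  - \sum_(l < q) z j l * xi i l.

Definition sigmaEm (A : comNzRingType) (p q : nat) (z xi : 'M[A]_(p, q))
    (i j : 'I_q) : A :=
  \sum_(k < p) z k i * xi k j.

Definition sigmaXp (A : comNzRingType) (p q : nat) (xi : 'M[A]_(p, q))
    (i : 'I_p) (j : 'I_q) : A :=
  - xi i j.

Definition sigmaXm (A : comNzRingType) (p q : nat) (z xi : 'M[A]_(p, q))
    (u : A) (i : 'I_p) (j : 'I_q) : A :=
  - u * z i j
  - \sum_(k < p | k != i) \sum_(l < q | l != j)
      (z i j * z k l - z i l * z k j) * xi k l.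

Section BasisMatrices.
Variables (A : comNzRingType) (p q : nat).

Definition Ep (i j : 'I_p) : 'M[A]_(p + q) := delta_mx (lshift q i) (lshift q j).
Definition Em (i j : 'I_q) : 'M[A]_(p + q) := delta_mx (rshift p i) (rshift p j).
Definition Xp (i : 'I_p) (j : 'I_q) : 'M[A]_(p + q) :=
  delta_mx (lshift q i) (rshift p j).
Definition Xm (i : 'I_p) (j : 'I_q) : 'M[A]_(p + q) :=
  delta_mx (rshift p j) (lshift q i).

(* E_(p+q,p+q), written as a sum with one term since 'I_(p + q) has no        *)
(* canonical last element when p and q are variables.                         *)
Definition Elast : 'M[A]_(p + q) :=
  \sum_(b < p + q | b.+1 == (p + q)%N) delta_mx b b.
Definition Hbasis (a : 'I_(p + q)) : 'M[A]_(p + q) := delta_mx a a - Elast.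

End BasisMatrices.

Arguments Ep {A p} q i j.
Arguments Em {A} p {q} i j.
Arguments Xp {A p q} i j.
Arguments Xm {A p q} i j.
Arguments Elast {A p q}.
Arguments Hbasis {A p q} a.

Definition sigma_offdiag (A : comNzRingType) (p q : nat)
    (z xi : 'M[A]_(p, q)) (u : A) : 'M[A]_(p + q) :=
  \sum_(i < p) \sum_(j < p | i != j) sigmaEp z xi j i *: Ep q i j
  + \sum_(i < q) \sum_(j < q | i != j) sigmaEm z xi j i *: Em p i j
  + \sum_(i < p) \sum_(j < q)
      (sigmaXm z xi u i j *: Xp i j + sigmaXp xi i j *: Xm i j).

(* The matrix of the determinant formula. Its (p+q,p+q) entry is given by the *)
(* same formula as the other entries (p+j,p+j); see sigmaX_H below.           *)
Definition sigmaX (F : fieldType) (A : comAlgType F) (p q : nat) (s : int)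
    (z xi : 'M[A]_(p, q)) (u : A) : 'M[A]_(p + q) :=
  \sum_(a < p + q) sigmaH s z xi u a *: delta_mx a a + sigma_offdiag z xi u.

(* The same matrix with the diagonal part expanded along H_1, ..., H_(p+q-1), *)
(* which forces its trace to be 0. It agrees with sigmaX when p = q, and in   *)
(* general modulo the relation u = s - gamma_1 (lemma sigmaX_H), but for      *)
(* p > q its determinant does not satisfy the formula in the free variable u: *)
(* for p = 2, q = 1, s = 0, z = xi = 0, u = 1 it is diag(1, 1, -2), of        *)
(* determinant -2, whereas the right-hand side of the formula is -1.          *)
Definition sigmaX_traceless (F : fieldType) (A : comAlgType F) (p q : nat)
    (s : int) (z xi : 'M[A]_(p, q)) (u : A) : 'M[A]_(p + q) :=
  \sum_(a < p + q | (a.+1 < p + q)%N) sigmaH s z xi u a *: Hbasis a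
  + sigma_offdiag z xi u.

Lemma sum_sigmaH (F : fieldType) (charF : [pchar F] =i pred0)
    (A : comAlgType F) (p q : nat) (s : int) (z xi : 'M[A]_(p, q)) (u : A) :
  (0 < q)%N ->
  \sum_(a < p + q) sigmaH s z xi u a
    = (p%:R - q%:R) * (u + (\sum_(k < p) \sum_(l < q) z k l * xi k l) - s%:~R).
Proof.
move=> q0; rewrite big_split_ord /=.
set g := \sum_(k < p) \sum_(l < q) z k l * xi k l.
pose r i := \sum_(l < q) z i l * xi i l.
pose c j := \sum_(k < p) z k j * xi k j.
pose x : A := (p%:R / (p + q)%:R * s%:~R)%:A.
pose y : A := (q%:R / (p + q)%:R * s%:~R)%:A.
have sr : \sum_(i < p) r i = g by [].
have sc : \sum_(j < q) c j = g by rewrite /c exchange_big.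
rewrite (eq_bigr (fun i => (u - x + g) - r i)); last first.
  move=> i _; rewrite /sigmaH (unsplitK (inl i)) -/x -[RHS]addrA; congr (_ + _).
  by apply/eqP; rewrite eq_sym subr_eq addrC /g (bigD1 i).
rewrite [X in _ + X](eq_bigr (fun j => (- u + y - g) + c j)); last first.
  move=> j _; rewrite /sigmaH (unsplitK (inr j)) -/y -[RHS]addrA; congr (_ + _).
  rewrite exchange_big /= -sc [in RHS](bigD1 j) //= opprD addrC addrA.
  by rewrite subrr add0r.
rewrite sumrB [X in _ + X]big_split /= sr sc !sumr_const !card_ord.
have n0 : (p + q)%:R != 0 :> F.
  rewrite ((pcharf0P F).1 charF) -lt0n; exact: leq_trans q0 (leq_addl _ _).
have xE : p%:R * x - q%:R * y = (p%:R - q%:R) * s%:~R.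
  rewrite /x /y -!(rmorph_nat (in_alg A)) -(rmorph_int (in_alg A)).
  rewrite -!(rmorphM (in_alg A)) -!(rmorphB (in_alg A)) -(rmorphM (in_alg A)).
  congr (in_alg A _); move: n0; rewrite natrD => n0; by field.
transitivity (p%:R * (u - x + g) - g + (q%:R * (- u + y - g) + g)).
  by rewrite !mulr_natl.
by rewrite [RHS]mulrBr -xE; ring.
Qed.

Lemma sigmaX_H (F : fieldType) (charF : [pchar F] =i pred0)
    (A : comAlgType F) (p q : nat) (s : int) (z xi : 'M[A]_(p, q)) (u : A) :
  (0 < q)%N ->
  sigmaX_traceless s z xi u
    = sigmaX s z xi u
      + ((p%:R - q%:R)
         * (s%:~R - (u + \sum_(k < p) \sum_(l < q) z k l * xi k l))) *: Elast.
Proof.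
move=> q0; set g := \sum_(k < p) \sum_(l < q) _.
have -> : (p%:R - q%:R) * (s%:~R - (u + g))
          = - \sum_(a < p + q) sigmaH s z xi u a.
  by rewrite sum_sigmaH // -mulrN opprB.
rewrite scaleNr /sigmaX_traceless /sigmaX addrAC; congr (_ + _).
rewrite scaler_suml [in RHS](bigID (fun a : 'I_(p + q) => (a.+1 < p + q)%N)) /=.
rewrite [X in _ = _ - X](bigID (fun a : 'I_(p + q) => (a.+1 < p + q)%N)) /=.
rewrite opprD addrACA -!sumrB [X in _ = _ + X]big1 ?addr0 => [|a].
  by apply: eq_bigr => a _; rewrite scalerBr.
rewrite -leqNgt => an; apply/eqP; rewrite subr_eq0; apply/eqP; congr (_ *: _).
rewrite /Elast (big_pred1 a) // => b /=.
have /eqP e : a.+1 == (p + q)%N by rewrite eqn_leq ltn_ord.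
by rewrite -[X in b.+1 == X]e eqSS.
Qed.

(* Main.v *)
Require Import Defs.
From mathcomp Require Import all_boot all_order all_algebra.
From mathcomp.multinomials Require Import mpoly.
From mathcomp Require Import ring.
Import GRing.Theory.
Local Open Scope ring_scope.


(** Put w = u + gamma_1, a = w - p s / (p + q) and b = w - q s / (p + q), so
    that a + b - w = w - s. In block form the matrix is

      [ a - z xi^T    z xi^T z - w z ]
      [ - xi^T        xi^T z - b     ]

    because the restricted sums in its entries can be completed: the sum over
    k <> i, or l <> j, in a diagonal entry is gamma_1 minus a diagonal entry of
    z xi^T, or of xi^T z, and the terms with k = i or l = j in sigma(X^-_(i,j))
    vanish. Conjugating by the unipotent matrix [1 z; 0 1]
    turns it into [ a  (w - s) z ; - xi^T  - b ], whose diagonal blocks are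
    scalar. Since q <= p, eliminating the corner a gives

      a ^ (p - q) * det (- a b + (w - s) xi^T z)
        = (-1) ^ q * a ^ (p - q) * det (a b + (s - w) xi^T z),

    and it remains to expand det (x + c N), N = xi^T z, in powers of c. The
    coefficient of c ^ k is x ^ (q - k) times the sum of the principal k-minors
    of N (det_scalar_add), which is gamma_k by the Cauchy-Binet formula
    (gamma_principal).

    Both facts come from the identity
    x ^ n det (x + A B) = x ^ m det (x + B A) (det_add_mulmxC). With x = 1 it
    reduces a determinant in which rows have been replaced by rows of the
    identity to a principal minor. With x an indeterminate, comparing the
    coefficients of degree n expresses det (A B) as the sum of the principal
    m-minors of B A: this is Cauchy-Binet, obtained with no sum over
    permutations. *)

(** * Principal minors and the Cauchy-Binet formula *)

(** Both sides are computed from the block matrix [x A; - B 1], by clearing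
    its lower left corner with column operations, respectively with row
    operations after its lower rows are multiplied by x. *)
Lemma det_add_mulmxC {R : comNzRingType} {m n : nat} (x : R)
    (A : 'M[R]_(m, n)) (B : 'M[R]_(n, m)) :
  x ^+ n * \det (x%:M + A *m B) = x ^+ m * \det (x%:M + B *m A).
Proof.
pose M := block_mx x%:M A (- B) 1%:M.
have detMr : \det M = \det (x%:M + A *m B).
  transitivity (\det (M *m block_mx 1%:M 0 B 1%:M)).
    by rewrite det_mulmx det_lblock !det1 !mulr1.
  rewrite mulmx_block !mulmx1 !mul1mx !mulmx0 addNr !add0r.
  by rewrite det_ublock det1 mulr1.
have detMl : x ^+ n * \det M = x ^+ m * \det (x%:M + B *m A).
  transitivity (\det (block_mx 1%:M 0 B x%:M *m M)).
    by rewrite det_mulmx det_lblock det1 det_scalar mul1r.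
  rewrite mulmx_block !mulmx1 !mul1mx !mul0mx !addr0.
  rewrite mul_mx_scalar mul_scalar_mx scalerN subrr.
  by rewrite det_ublock det_scalar addrC.
by rewrite -detMr.
Qed.

(** The matrix on the left is 1 + S T, where the columns of S are the unit
    vectors indexed by J and T consists of the rows of N - 1 indexed by J;
    exchanging the factors gives 1 + T S, which is the submatrix of N on J. *)
Lemma det_replace_rows {R : comNzRingType} {n : nat} (N : 'M[R]_n)
    (J : {set 'I_n}) :
  \det (\matrix_(i, j) (if i \in J then N i j else (i == j)%:R)) =
  \det (mxsub (@enum_val _ (mem J)) (@enum_val _ (mem J)) N).
Proof.
set e := @enum_val _ _.
have -> : \matrix_(i, j) (if i \in J then N i j else (i == j)%:R)
          = 1%:M + colsub e 1%:M *m rowsub e (N - 1%:M).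
  apply/matrixP=> i j; rewrite !mxE.
  case: ifPn => iJ.
    have -> : N i j = (i == j)%:R + (N - 1%:M) i j by rewrite !mxE; ring.
    congr (_ + _); rewrite (bigD1 (enum_rank_in iJ i)) //= big1 => [|l il].
      by rewrite !mxE /e enum_rankK_in // eqxx mul1r addr0.
    rewrite !mxE; case: (eqVneq i (e l)) il => [iel|_ _]; last first.
      by rewrite mulr0n mul0r.
    by case/eqP; apply: enum_val_inj; rewrite enum_rankK_in // iel.
  rewrite big1 ?addr0 // => l _; rewrite !mxE.
  case: (eqVneq i (e l)) iJ => [->|_ _].
    by rewrite enum_valP.
  by rewrite mulr0n mul0r.
have := det_add_mulmxC 1 (colsub e 1%:M) (rowsub e (N - 1%:M)).
rewrite !expr1n !mul1r => ->; rewrite -mxsub_mul mulmx1; congr (\det _).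
by apply/matrixP=> i j; rewrite !mxE (inj_eq enum_val_inj); ring.
Qed.

(** Multilinearity in the rows: J is the set of rows taken from N, and each of
    the other rows contributes a factor x. *)
Lemma det_scalar_add {R : comNzRingType} {n : nat} (x : R) (N : 'M[R]_n) :
  \det (x%:M + N) = \sum_(J : {set 'I_n}) x ^+ (n - #|J|) *
    \det (mxsub (@enum_val _ (mem J)) (@enum_val _ (mem J)) N).
Proof.
pose W (J : {set 'I_n}) : 'M[R]_n :=
  \matrix_(i, j) (if i \in J then N i j else x%:M i j).
transitivity (\sum_(J : {set 'I_n}) \det (W J)).
  rewrite [RHS]exchange_big; apply: eq_bigr => s _ /=.
  rewrite -big_distrr /=; congr (_ * _).
  under eq_bigr => i _ do rewrite mxE addrC.
  rewrite bigA_distr; apply: eq_bigr => J _.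
  by apply: eq_bigr => i _; rewrite [RHS]mxE.
apply: eq_bigr => J _; rewrite -det_replace_rows.
have -> : W J = diag_mx (\row_i if i \in J then 1 else x) *m
    \matrix_(i, j) (if i \in J then N i j else (i == j)%:R).
  apply/matrixP=> i j; rewrite mul_diag_mx !mxE; case: ifP => _.
    by rewrite mul1r.
  by rewrite mulr_natr.
rewrite det_mulmx det_diag; congr (_ * _).
under eq_bigr => i _ do rewrite mxE.
rewrite (bigID (mem J)) /= big1 ?mul1r => [|i ->//].
rewrite (eq_bigr (fun=> x)) => [|i /negPf ->//].
rewrite prodr_const; congr (_ ^+ _).
transitivity #|~: J|; first by apply: eq_card => i; rewrite !inE.
by have := cardsC J; rewrite card_ord; apply: canRL (addKn _).
Qed.

(** The Cauchy-Binet formula, each product of two maximal minors being written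
    as one principal minor of B A. This form does not compare the orderings
    of two enumerations of I. It is the coefficient of degree n in
    'X^n det ('X + A B) = 'X^m det ('X + B A): on the left it is the value at 0
    of det ('X + A B), on the right it selects the principal minors of
    size m. *)
Lemma det_mulmx_principal {R : comNzRingType} {m n : nat} (A : 'M[R]_(m, n))
    (B : 'M[R]_(n, m)) :
  \det (A *m B) = \sum_(I : {set 'I_n} | #|I| == m)
     \det (mxsub (@enum_val _ (mem I)) (@enum_val _ (mem I)) (B *m A)).
Proof.
pose A' := map_mx polyC A; pose B' := map_mx polyC B.
have /(congr1 (fun P : {poly R} => P`_n)) := det_add_mulmxC 'X A' B'.
(* The coefficient 0 on the left is obtained by evaluation at 0. *)
rewrite coefXnM ltnn subnn -horner_coef0 -horner_evalE -det_map_mx.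
rewrite map_mxD map_scalar_mx /= horner_evalE hornerX raddf0 add0r.
rewrite -map_mxM /= -map_mx_comp map_mx_id => [->|c]; last first.
  by rewrite /= horner_evalE hornerC.
rewrite det_scalar_add mulr_sumr coef_sum [RHS]big_mkcond /=.
apply: eq_bigr => I _; rewrite -map_mxM -map_mxsub det_map_mx.
rewrite mulrA -exprD mulrC mul_polyC coefZ coefXn.
have In : (#|I| <= n)%N by rewrite -[n in (_ <= n)%N]card_ord max_card.
have -> : (n == m + (n - #|I|))%N = (#|I| == m).
  by rewrite -(eqn_add2r (n - #|I|) #|I| m) subnKC.
by case: eqP; rewrite ?mulr1 ?mulr0.
Qed.

(** Clearing the block B requires multiplying q columns by a, hence dividing
    by a ^+ q at the end. Over an arbitrary commutative ring this is legitimate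
    when a is replaced by the indeterminate 'X, which is regular; the general
    case follows by evaluation at a. *)
Lemma det_block_scalar {R : comNzRingType} {p q : nat} (a : R)
    (B : 'M[R]_(p, q)) (C : 'M[R]_(q, p)) (D : 'M[R]_q) :
  (q <= p)%N ->
  \det (block_mx a%:M B C D) = a ^+ (p - q) * \det (a *: D - C *m B).
Proof.
move=> qp; pose f := map_mx (@polyC R).
suff E : \det (block_mx 'X%:M (f _ _ B) (f _ _ C) (f _ _ D))
         = 'X ^+ (p - q) * \det ('X *: f _ _ D - f _ _ C *m f _ _ B).
  have fK m n (N : 'M[R]_(m, n)) : map_mx (horner_eval a) (f _ _ N) = N.
    by rewrite -map_mx_comp map_mx_id // => c /=; rewrite horner_evalE hornerC.
  have /(congr1 (horner_eval a)) := E.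
  rewrite rmorphM rmorphXn /= -!det_map_mx map_block_mx map_scalar_mx !fK.
  by rewrite map_mxB map_mxZ map_mxM !fK /= horner_evalE hornerX.
apply: (monic_lreg (monicXn R q)).
rewrite mulrA -exprD subnKC //.
transitivity (\det (block_mx 'X%:M (f _ _ B) (f _ _ C) (f _ _ D) *m
                    block_mx 1%:M (- f _ _ B) 0 'X%:M)).
  by rewrite det_mulmx det_ublock det1 det_scalar mul1r mulrC.
rewrite mulmx_block !mulmx1 !mulmx0 !addr0 mulmxN mul_scalar_mx mul_mx_scalar.
rewrite addNr det_lblock det_scalar; congr (_ * \det _).
by rewrite mulmxN mul_mx_scalar addrC.
Qed.

(** * The polynomials gamma_k *)

(** With m and n variables, the equalities with k can be substituted, which
    removes the casts in the definition of minor; for the cardinals to which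
    this is applied that is not possible. *)
Lemma det_mul_conform {R : comNzRingType} {m n k : nat} (X Y : 'M[R]_(m, n)) :
  m = k -> n = k ->
  \det (X *m Y^T) =
    \det (conform_mx (0 : 'M[R]_k) X) * \det (conform_mx (0 : 'M[R]_k) Y).
Proof.
move=> mk nk; subst m n.
by rewrite !conform_mx_id det_mulmx det_tr.
Qed.

(** Cauchy-Binet for each principal submatrix of xi^T z, a product of a k x p
    matrix by a p x k one. *)
Lemma gamma_principal {R : comNzRingType} {p q : nat} (z xi : 'M[R]_(p, q))
    (k : nat) :
  gamma z xi k = \sum_(J : {set 'I_q} | #|J| == k)
    \det (mxsub (@enum_val _ (mem J)) (@enum_val _ (mem J)) (xi^T *m z)).
Proof.
rewrite /gamma exchange_big; apply: eq_bigr => J /eqP Jk.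
rewrite mxsub_mul det_mulmx_principal; apply: eq_big => [I|I /eqP Ik].
  by rewrite Jk.
rewrite mxsub_mul /minor -det_mul_conform //.
by congr (\det (_ *m _)); apply/matrixP=> i j; rewrite !mxE.
Qed.

Lemma det_scalar_gamma {R : comNzRingType} {p q : nat} (x c : R)
    (z xi : 'M[R]_(p, q)) :
  \det (x%:M + c *: (xi^T *m z))
    = \sum_(k < q.+1) x ^+ (q - k) * c ^+ k * gamma z xi k.
Proof.
rewrite det_scalar_add.
have Jq (J : {set 'I_q}) : (#|J| < q.+1)%N.
  by rewrite ltnS -[q in (_ <= q)%N]card_ord max_card.
rewrite (partition_big (fun J : {set 'I_q} => Ordinal (Jq J)) xpredT) //=.
apply: eq_bigr => k _; rewrite gamma_principal mulr_sumr.
apply: eq_big => [J|J /eqP <- /=]; first by rewrite -val_eqE.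
rewrite -mulrA -detZ; congr (_ * \det _).
by apply/matrixP=> i j; rewrite !mxE.
Qed.

Lemma sum_card1 {R : nmodType} {T : finType} (f : {set T} -> R) :
  \sum_(I : {set T} | #|I| == 1%N) f I = \sum_i f [set i].
Proof.
rewrite -(big_imset f (in2W set1_inj)); apply: eq_bigl => I /=.
apply/cards1P/imsetP => [[i ->]|[i _ ->]]; last by exists i.
by exists i.
Qed.

Lemma det_conform1 {R : comNzRingType} {m n : nat} (X : 'M[R]_(m, n))
    (i : 'I_m) (j : 'I_n) :
  m = 1%N -> n = 1%N -> \det (conform_mx (0 : 'M[R]_1) X) = X i j.
Proof.
move=> m1 n1; subst m n.
by rewrite conform_mx_id det_mx11 (ord1 i) (ord1 j).
Qed.

Lemma minor1 {R : comNzRingType} {p q : nat} (z : 'M[R]_(p, q)) i j :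
  minor 1 z [set i] [set j] = z i j.
Proof.
rewrite /minor (det_conform1 _ (enum_rank_in (set11 i) i)
  (enum_rank_in (set11 j) j)) ?cards1 //.
by rewrite mxE !enum_rankK_in ?set11.
Qed.

Lemma gamma1 {R : comNzRingType} {p q : nat} (z xi : 'M[R]_(p, q)) :
  gamma z xi 1 = \sum_k \sum_l z k l * xi k l.
Proof.
rewrite /gamma sum_card1; apply: eq_bigr => k _; rewrite sum_card1.
by apply: eq_bigr => l _; rewrite !minor1.
Qed.

(** * The block form of the matrix *)

Lemma sigmaH_l (F : fieldType) (A : comAlgType F) (p q : nat) (s : int)
    (z xi : 'M[A]_(p, q)) (u : A) (i : 'I_p) :
  sigmaH s z xi u (lshift q i)
    = u + gamma z xi 1 - (p%:R / (p + q)%:R * s%:~R)%:A - (z *m xi^T) i i.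
Proof.
rewrite /sigmaH (unsplitK (inl i)) gamma1 [in RHS](bigD1 i) //= mxE.
under [X in _ = _ - X]eq_bigr => l _ do rewrite mxE.
by ring.
Qed.

Lemma sigmaH_r (F : fieldType) (A : comAlgType F) (p q : nat) (s : int)
    (z xi : 'M[A]_(p, q)) (u : A) (j : 'I_q) :
  sigmaH s z xi u (rshift p j)
    = (xi^T *m z) j j - (u + gamma z xi 1 - (q%:R / (p + q)%:R * s%:~R)%:A).
Proof.
rewrite /sigmaH (unsplitK (inr j)) gamma1 mxE.
rewrite exchange_big [in RHS]exchange_big [in RHS](bigD1 j) //=.
under [X in _ = X - _]eq_bigr => k _ do rewrite mxE mulrC.
by ring.
Qed.

(** The terms with k = i or l = j are zero, so that the double sum can be taken
    over all k and l, where it is z_(i,j) gamma_1 - (z xi^T z)_(i,j). *)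
Lemma sigmaXmE {R : comNzRingType} {p q : nat} (z xi : 'M[R]_(p, q)) (u : R)
    i j :
  sigmaXm z xi u i j
    = (z *m xi^T *m z - (u + gamma z xi 1) *: z) i j.
Proof.
have full : \sum_(k < p | k != i) \sum_(l < q | l != j)
      (z i j * z k l - z i l * z k j) * xi k l
    = \sum_k \sum_l (z i j * z k l - z i l * z k j) * xi k l.
  rewrite [RHS](bigD1 i) //= [X in _ = X + _]big1 ?add0r => [|l _];
    last by ring.
  apply: eq_bigr => k _; rewrite [RHS](bigD1 j) //= [X in _ = X + _](_ : _ = 0).
    by rewrite add0r.
  by ring.
rewrite /sigmaXm full -mulmxA !mxE gamma1.
have -> : \sum_k \sum_l (z i j * z k l - z i l * z k j) * xi k l
   = z i j * (\sum_k \sum_l z k l * xi k l)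
     - \sum_l z i l * (xi^T *m z) l j.
  under [X in _ = _ - X]eq_bigr => l _ do rewrite mxE mulr_sumr.
  rewrite [X in _ = _ - X]exchange_big mulr_sumr -sumrB.
  apply: eq_bigr => k _; rewrite mulr_sumr -sumrB.
  by apply: eq_bigr => l _; rewrite mxE; ring.
by ring.
Qed.

(** The expansion of a matrix along the basis used for sigmaX, so that a block
    formula for sigmaX can be checked one coefficient at a time. *)
Lemma matrix_sum_blocks {R : comNzRingType} {p q : nat} (M : 'M[R]_(p + q)) :
  M = \sum_a M a a *: delta_mx a a
    + (\sum_(i < p) \sum_(j < p | i != j)
         M (lshift q i) (lshift q j) *: Ep q i j
     + \sum_(i < q) \sum_(j < q | i != j)
         M (rshift p i) (rshift p j) *: Em p i j
     + \sum_(i < p) \sum_(j < q) (M (lshift q i) (rshift p j) *: Xp i j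
                                + M (rshift p j) (lshift q i) *: Xm i j)).
Proof.
rewrite [LHS]matrix_sum_delta !big_split_ord /=.
rewrite (eq_bigr (fun i =>
    M (lshift q i) (lshift q i) *: delta_mx (lshift q i) (lshift q i)
    + \sum_(j < p | i != j) M (lshift q i) (lshift q j) *: Ep q i j
    + \sum_(j < q) M (lshift q i) (rshift p j) *: Xp i j)); last first.
  move=> i _; rewrite big_split_ord (bigD1 i) //=; congr (_ + _ + _).
  by apply: eq_bigl => j; rewrite eq_sym.
rewrite [X in _ + X = _](eq_bigr (fun i =>
    \sum_(j < p) M (rshift p i) (lshift q j) *: Xm j i
    + (M (rshift p i) (rshift p i) *: delta_mx (rshift p i) (rshift p i)
       + \sum_(j < q | i != j) M (rshift p i) (rshift p j) *: Em p i j)));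
  last first.
  move=> i _; rewrite big_split_ord; congr (_ + _); rewrite (bigD1 i) //=.
  by congr (_ + _); apply: eq_bigl => j; rewrite eq_sym.
under [X in _ = _ + (_ + X)]eq_bigr => i _ do rewrite big_split.
rewrite !big_split /= [X in _ + (X + _) = _]exchange_big /=.
rewrite [X in _ + X = _]addrCA [in RHS]addrACA -!addrA; congr (_ + _).
congr (_ + _); rewrite addrCA [in RHS]addrCA; congr (_ + _).
by rewrite addrA addrC.
Qed.

Lemma sigmaX_block (F : fieldType) (A : comAlgType F) (p q : nat) (s : int)
    (z xi : 'M[A]_(p, q)) (u : A) :
  let w := u + gamma z xi 1 in
  sigmaX s z xi u =
    block_mx ((w - (p%:R / (p + q)%:R * s%:~R)%:A)%:M - z *m xi^T)
             (z *m xi^T *m z - w *: z)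
             (- xi^T)
             (xi^T *m z - (w - (q%:R / (p + q)%:R * s%:~R)%:A)%:M).
Proof.
move=> w; rewrite [RHS]matrix_sum_blocks /sigmaX /sigma_offdiag.
congr (_ + (_ + _ + _)).
- rewrite !big_split_ord /=; congr (_ + _); apply: eq_bigr => i _;
    congr (_ *: _);
    [rewrite block_mxEul sigmaH_l | rewrite block_mxEdr sigmaH_r].
    by rewrite [RHS]mxE [X in _ = X + _]mxE eqxx [X in _ = _ + X]mxE.
  by rewrite [RHS]mxE [X in _ = _ + X]mxE [X in _ = _ - X]mxE eqxx.
- apply: eq_bigr => i _; apply: eq_bigr => j ij; congr (_ *: _).
  rewrite block_mxEul !mxE (negPf ij) /sigmaEp add0r; congr (- _).
  by apply: eq_bigr => l _; rewrite !mxE.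
- apply: eq_bigr => i _; apply: eq_bigr => j ij; congr (_ *: _).
  rewrite block_mxEdr !mxE (negPf ij) /sigmaEm subr0.
  by apply: eq_bigr => l _; rewrite !mxE mulrC.
- apply: eq_bigr => i _; apply: eq_bigr => j _; congr (_ *: _ + _ *: _).
    by rewrite block_mxEur sigmaXmE.
  by rewrite block_mxEdl !mxE.
Qed.

(** * The determinant formula *)

(** The formula is an identity in any commutative algebra over a field of
    characteristic 0. *)
Lemma det_sigmaX (F : fieldType) (charF : [pchar F] =i pred0)
    (A : comAlgType F) (p q : nat) (s : int)
    (z xi : 'M[A]_(p, q)) (u : A) :
  (0 < q)%N -> (q <= p)%N ->
  let w := u + gamma z xi 1 in
  let a := w - (p%:R / (p + q)%:R * s%:~R)%:A in
  let b := w - (q%:R / (p + q)%:R * s%:~R)%:A in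
  \det (sigmaX s z xi u) =
    (-1) ^+ q * \sum_(k < q.+1)
       a ^+ (p - k) * b ^+ (q - k) * (s%:~R - w) ^+ k * gamma z xi k.
Proof.
move=> q0 qp w a b.
have n0 : (p + q)%:R != 0 :> F.
  rewrite ((pcharf0P F).1 charF) -lt0n; exact: leq_trans q0 (leq_addl _ _).
have abE : a + b - w = w - s%:~R.
  have -> : s%:~R = (p%:R / (p + q)%:R * s%:~R)%:A
                  + (q%:R / (p + q)%:R * s%:~R)%:A :> A.
    rewrite -scalerDl -mulrDl -mulrDl -natrD divff // mul1r.
    by rewrite -(rmorph_int (in_alg A)).
  by rewrite /a /b; ring.
(* Conjugation by the unipotent matrix [1 z; 0 1]. *)
transitivity (\det (block_mx a%:M ((w - s%:~R) *: z) (- xi^T) (- b)%:M)).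
  have /(congr1 determinant) : sigmaX s z xi u *m block_mx 1%:M z 0 1%:M
      = block_mx 1%:M z 0 1%:M
        *m block_mx a%:M ((w - s%:~R) *: z) (- xi^T) (- b)%:M.
    rewrite sigmaX_block -/w -/a -/b !mulmx_block.
    rewrite !mulmx1 !mul1mx !mulmx0 !mul0mx !addr0 !add0r.
    rewrite mulmxBl mulNmx mulmxN mul_scalar_mx mul_mx_scalar.
    congr (block_mx _ _ _ _).
      rewrite -abE; apply/matrixP=> i j; rewrite !mxE; ring.
    by apply/matrixP=> i j; rewrite !mxE; ring.
  by rewrite !det_mulmx !det_ublock !det1 !mul1r mulr1.
rewrite det_block_scalar //.
have -> : a *: (- b)%:M - - xi^T *m ((w - s%:~R) *: z)
    = (-1) *: ((a * b)%:M + (s%:~R - w) *: (xi^T *m z)).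
  rewrite mulNmx -scalemxAr; apply/matrixP=> i j; rewrite !mxE; ring.
rewrite detZ det_scalar_gamma mulrCA; congr (_ * _).
rewrite mulr_sumr; apply: eq_bigr => k _.
have kq : (k <= q)%N by rewrite -ltnS.
have -> : (p - k = (p - q) + (q - k))%N by rewrite addnBA // subnK.
by rewrite exprD exprMn !mulrA.
Qed.

Theorem corollary6p4 (F : fieldType) (charF : [pchar F] =i pred0)
    (p q : nat) (hq : (1 <= q)%N) (hpq : (q <= p)%N) (s : int) :
  let z := zX F p q in
  let xi := xiX F p q in
  let u := uX F p q in
  let gam := gamma z xi in
  let sc (c : F) : pring F p q := (c * s%:~R)%:A in
  \det (sigmaX s z xi u) =
    (-1) ^+ q *
    \sum_(k < q.+1)
       (u + gam 1%N - sc (p%:R / (p + q)%:R)) ^+ (p - k) *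
       (u + gam 1%N - sc (q%:R / (p + q)%:R)) ^+ (q - k) *
       (s%:~R - (u + gam 1%N)) ^+ k * gam k.
Proof. by move=> z xi u gam sc; exact: det_sigmaX. Qed.
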